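(* Let $F$ be Thompson's group $F$, acting on $[0,1]$ in the standard way by piecewise linear homeomorphisms, and let $\mathrm{Orb}(1/2)=\{g(1/2): g\in F\}$ be the orbit of $1/2$ under this action. Then there exists a non-degenerate symmetric probability measure $\mu$ on $F$ such that the action of $F$ on $\mathrm{Orb}(1/2)$ is $\mu$-Liouville.
   Context: Thompson's group $F$ is the group (under composition) of all orientation-preserving piecewise linear homeomorphisms of $[0,1]$ that have finitely many breakpoints, all at dyadic rationals, and all of whose slopes are integer powers of $2$. Let a discrete group $G$ act on a countable set $X$ and let $\mu$ be a probability measure on $G$. The measure $\mu$ is non-degenerate if its support $\{g:\mu(g)>0\}$ generates $G$ as a group, and symmetric if $\mu(g)=\mu(g^{-1})$ for all $g\in G$. The transition matrix on $X$ induced by $\mu$ is $P_\mu(x,y)=\sum_{g\in G}\mathbf{1}_{\{g\cdot x=y\}}\mu(g)$. A function $f:X\to\mathbb{R}$ is $P_\mu$-harmonic if $f(x)=\sum_{y\in X}f(y)P_\mu(x,y)$ for all $x\in X$. The action is $\mu$-Liouville if all bounded $P_\mu$-harmonic functions on $X$ are constant. The measure $\mu$ is not required to have finite support. *)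

(* Defs.v *)
From HB Require Import structures.
From mathcomp Require Import all_boot all_order all_algebra.
From mathcomp Require Import all_classical all_reals all_analysis.
From mathcomp Require Import ring lra.

Set Implicit Arguments.
Unset Strict Implicit.
Unset Printing Implicit Defensive.

Import Order.TTheory GRing.Theory Num.Theory numFieldNormedType.Exports.

Local Open Scope classical_set_scope.
Local Open Scope ring_scope.

Record left_action (G : groupType) (X : Type) := LeftAction {
  act :> G -> X -> X ;
  act1 : forall x, act 1%g x = x ;
  actM : forall g h x, act (g * h)%g x = act g (act h x)
}.

Definition left_orbit (G : groupType) (X : Type) (a : left_action G X) (x0 : X) :
  set X := [set a g x0 | g in [set: G]].

Section OrbitAction.
Context (G : groupType) (X : Type) (a : left_action G X) (x0 : X).

Lemma orbit_stable (g : G) (x : left_orbit a x0) :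
  a g (\val x) \in left_orbit a x0.
Proof.
case: x => x /= /set_mem[h _ <-]; apply/mem_set.
by exists (g * h)%g => //; rewrite actM.
Qed.

Definition orbit_act (g : G) (x : left_orbit a x0) : left_orbit a x0 :=
  exist _ (a g (\val x)) (orbit_stable g x).

Lemma orbit_act1 x : orbit_act 1%g x = x.
Proof. by apply: val_inj; rewrite /= act1. Qed.

Lemma orbit_actM g h x : orbit_act (g * h)%g x = orbit_act g (orbit_act h x).
Proof. by apply: val_inj; rewrite /= actM. Qed.

Definition orbit_action : left_action G (left_orbit a x0) :=
  LeftAction orbit_act1 orbit_actM.

End OrbitAction.

Section RandomWalk.
Context (R : realType) (G : groupType) (X : choiceType).
Implicit Types (mu : G -> R) (a : left_action G X) (f : X -> R).

(** A probability measure on a discrete group is given by its point masses. *)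
Definition prob_measure mu : Prop :=
  (forall g, 0 <= mu g) /\ (\esum_(g in [set: G]) (mu g)%:E = 1)%E.

Definition supp mu : set G := [set g | 0 < mu g].

Definition is_subgroup (H : set G) : Prop :=
  [/\ H 1%g, forall g h, H g -> H h -> H (g * h)%g & forall g, H g -> H g^-1%g].

Definition nondegenerate_measure mu : Prop :=
  smallest is_subgroup (supp mu) = [set: G].

Definition symmetric_measure mu : Prop := forall g, mu g = mu g^-1%g.

Definition transition a mu (x y : X) : R :=
  fine (\esum_(g in [set g | a g x = y]) (mu g)%:E)%E.

(** [\esum] is meant for nonnegative families, so the sum of an absolutely
    summable signed family is split into its positive and negative parts. *)
Definition harmonic_fun a mu f : Prop :=
  forall x, let u := fun y => (f y * transition a mu x y)%:E in
    summable [set: X] u /\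
    (f x)%:E = (\esum_(y in [set: X]) u^\+ y - \esum_(y in [set: X]) u^\- y)%E.

Definition liouville a mu : Prop :=
  forall f, bounded_fun f -> harmonic_fun a mu f -> exists c, forall x, f x = c.

End RandomWalk.

Definition unit_itv (R : realType) : set R := `[0, 1]%classic.
Arguments unit_itv R : clear implicits.

Definition dyadic (R : realType) (x : R) : Prop :=
  exists (m : int) (n : nat), x = m%:~R / 2 ^+ n.

(** [set_type] carries the topology induced by the ambient space. *)
Definition homeomorphism (T U : topologicalType) (g : T -> U) : Prop :=
  continuous g /\
  exists h : U -> T, [/\ continuous h, cancel g h & cancel h g].

(** [s] lists the breakpoints, possibly among other dyadic points: [g] is affine
    on each subinterval whose interior contains no point of [s]. *)
Definition pl_dyadic (R : realType) (g : unit_itv R -> unit_itv R) : Prop :=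
  exists2 s : seq R, (forall b, b \in s -> dyadic b) &
    forall a b : unit_itv R, \val a < \val b ->
      (forall c, c \in s -> ~~ (\val a < c < \val b)) ->
      exists (k : int) (c : R), forall x : unit_itv R,
        \val a <= \val x <= \val b -> \val (g x) = 2 ^ k * \val x + c.

Definition thompson_set (R : realType) : set (unit_itv R -> unit_itv R) :=
  [set g : unit_itv R -> unit_itv R |
    [/\ homeomorphism g, {homo g : x y / \val x < \val y} & pl_dyadic g]].
Arguments thompson_set R : clear implicits.

Definition thompsonF (R : realType) : Type := thompson_set R.
HB.instance Definition _ (R : realType) :=
  Choice.copy (thompsonF R) (set_type (thompson_set R)).

Section ThompsonGroup.
Context (R : realType).
Local Notation I := (set_type (unit_itv R)).
Implicit Types (g h : I -> I) (x y : I).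

Lemma dyadic0 : dyadic (0 : R).
Proof. by exists 0, 0%N; rewrite mul0r. Qed.

Lemma dyadicD (x y : R) : dyadic x -> dyadic y -> dyadic (x + y).
Proof.
move=> [m [i ->]] [n [j ->]]; exists (m * 2 ^+ j + n * 2 ^+ i), (i + j)%N.
rewrite rmorphD !rmorphM !rmorphXn /= exprD.
have hi : (2 : R) ^+ i != 0 by rewrite expf_neq0// pnatr_eq0.
have hj : (2 : R) ^+ j != 0 by rewrite expf_neq0// pnatr_eq0.
by field; rewrite hi hj.
Qed.

Lemma dyadicN (x : R) : dyadic x -> dyadic (- x).
Proof. by move=> [m [i ->]]; exists (- m), i; rewrite rmorphN mulNr. Qed.

Lemma dyadic_pow2M (k : int) (x : R) : dyadic x -> dyadic (2 ^ k * x).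
Proof.
move=> [m [i ->]]; case: k => k.
  exists (2 ^+ k * m), i; rewrite rmorphM rmorphXn /= mulrA.
  by rewrite exprnP.
exists m, (i + k.+1)%N.
by rewrite NegzE -exprnN exprD invfM mulrCA mulrA [RHS]mulrA mulrAC.
Qed.

Lemma dyadicB (x y : R) : dyadic x -> dyadic y -> dyadic (x - y).
Proof. by move=> dx dy; apply: dyadicD => //; exact: dyadicN. Qed.

Lemma unit_itvP x : 0 <= \val x <= 1.
Proof. by case: x => x /= /set_mem; rewrite /unit_itv /= in_itv. Qed.

Lemma unit_itv_in (r : R) : 0 <= r <= 1 -> r \in unit_itv R.
Proof. by move=> r01; apply/mem_set; rewrite /unit_itv /= in_itv. Qed.

Definition zeroI : I := exist _ 0 (unit_itv_in (introT andP (conj (lexx 0) ler01))).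

Lemma thompson_mono g : {homo g : x y / \val x < \val y} ->
  {mono g : x y / \val x < \val y}.
Proof.
move=> gm x y; case: (ltgtP (\val x) (\val y)) => [/gm//|/gm h|/val_inj->].
  by apply/negbTE; rewrite -leNgt ltW.
exact: ltxx.
Qed.

Lemma thompson_monole g : {homo g : x y / \val x < \val y} ->
  {mono g : x y / \val x <= \val y}.
Proof. by move=> gm x y; rewrite !leNgt (thompson_mono gm). Qed.

Lemma thompson_inv_homo g h : {homo g : x y / \val x < \val y} ->
  cancel h g -> {homo h : x y / \val x < \val y}.
Proof. by move=> gm hg x y xy; rewrite -(thompson_mono gm) !hg. Qed.

Lemma thompson_fix0 g h : {homo g : x y / \val x < \val y} ->
  cancel h g -> g zeroI = zeroI.
Proof.
move=> gm hg; apply/val_inj/le_anti.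
have /andP[-> _] := unit_itvP (g zeroI); rewrite andbT.
have := thompson_monole gm zeroI (h zeroI); rewrite hg => ->.
by have /andP[] := unit_itvP (h zeroI).
Qed.

Lemma seq_maxP (t : seq R) : t != [::] ->
  exists2 p, p \in t & forall q, q \in t -> q <= p.
Proof.
elim: t => // a [|b t] IH _.
  by exists a; [rewrite mem_head|move=> q; rewrite inE => /eqP->].
have [//|p pt pm] := IH; have [ap|pa] := leP a p.
  exists p; first by rewrite inE pt orbT.
  by move=> q; rewrite inE => /predU1P[->//|/pm].
exists a; first exact: mem_head.
move=> q; rewrite inE => /predU1P[->//|/pm qp].
exact: le_trans qp (ltW pa).
Qed.

Lemma count_lt (T : eqType) (a1 a2 : pred T) (s : seq T) (p : T) :
  subpred a1 a2 -> p \in s -> a2 p -> ~~ a1 p -> (count a1 s < count a2 s)%N.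
Proof.
move=> a12 + a2p a1p; elim: s => //= x s IH; rewrite inE => /predU1P[<-|/IH lt].
  by rewrite a2p (negbTE a1p) ltnS sub_count.
by rewrite -addnS leq_add//; case: (a1 x) (a12 x) => // ->.
Qed.

Lemma thompson_dyadic g h : {homo g : x y / \val x < \val y} ->
  cancel h g -> pl_dyadic g -> forall x, dyadic (\val x) <-> dyadic (\val (g x)).
Proof.
move=> gm hg [s ds gs] x.
have [n] := ubnP (size [seq c <- s | 0 <= c < \val x]).
elim: n x => // n IH x szx.
have /andP[x0 x1] := unit_itvP x.
case: (eqVneq x zeroI) => [->|xN0]; first by rewrite (thompson_fix0 gm hg).
have xgt0 : 0 < \val x.
  rewrite lt_neqAle x0 andbT; apply: contra xN0 => /eqP e.
  by apply/eqP/val_inj; rewrite -e.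
suff [p [px dp dgp ps]] : exists p : I, [/\ \val p < \val x, dyadic (\val p),
    dyadic (\val (g p)) & forall c, c \in s -> ~~ (\val p < c < \val x)].
  have [k [c kc]] := gs p x px ps.
  have ep : \val (g p) = 2 ^ k * \val p + c by apply: kc; rewrite lexx ltW.
  have ex : \val (g x) = 2 ^ k * \val x + c by apply: kc; rewrite lexx ltW.
  have dc : dyadic c.
    have -> : c = \val (g p) - 2 ^ k * \val p by rewrite ep addrC addKr.
    by apply: dyadicB => //; exact: dyadic_pow2M.
  rewrite ex; split=> [dx|dgx]; first by apply: dyadicD => //; exact: dyadic_pow2M.
  have -> : \val x = 2 ^ (- k) * (2 ^ k * \val x + c - c).
    by rewrite addrK mulrA -expfzDr ?pnatr_eq0// addNr expr0z mul1r.
  by apply: dyadic_pow2M; apply: dyadicB.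
case: (eqVneq [seq c <- s | 0 <= c < \val x] [::]) => [s0|/seq_maxP[p]].
  exists zeroI; split => //=; rewrite ?(thompson_fix0 gm hg); try exact: dyadic0.
  move=> c cs; apply/negP => /andP[c0 cx].
  suff : c \in [seq c <- s | 0 <= c < \val x] by rewrite s0.
  by rewrite mem_filter cs cx ltW.
rewrite mem_filter => /andP[/andP[p0 px] ps] pm.
have pI : 0 <= p <= 1 by rewrite p0 ltW// (lt_le_trans px).
pose P : I := exist _ p (unit_itv_in pI).
exists P; split => //=; first exact: ds.
- apply/(IH P); last exact: ds.
  rewrite ltnS in szx; apply: leq_trans szx.
  rewrite !size_filter.
  apply: (@count_lt _ _ _ _ p) => //=; last 2 first.
  + by rewrite p0.
  + by rewrite ltxx andbF.
  by move=> c /andP[-> cp]; exact: lt_trans cp px.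
- move=> c cs; apply/negP => /andP[pc cx].
  suff /pm : c \in [seq c <- s | 0 <= c < \val x] by rewrite leNgt pc.
  by rewrite mem_filter cs cx (le_trans p0 (ltW pc)).
Qed.

Lemma homeomorphism_id (T : topologicalType) : homeomorphism (@id T).
Proof. by split; [|exists id; split] => // x; exact: cvg_id. Qed.

Lemma homeomorphism_comp (T U V : topologicalType) (f : U -> V) (g : T -> U) :
  homeomorphism f -> homeomorphism g -> homeomorphism (f \o g).
Proof.
move=> [cf [f' [cf' ff' f'f]]] [cg [g' [cg' gg' g'g]]]; split.
  by move=> x; apply: continuous_comp; [exact: cg|exact: cf].
exists (g' \o f'); split; [|exact: can_comp|exact: can_comp].
by move=> x; apply: continuous_comp; [exact: cf'|exact: cg'].
Qed.

Lemma thompson_set_id : thompson_set R id.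
Proof.
split; [exact: homeomorphism_id|by []|].
exists [::] => // a b _ _; exists 0, 0 => x _.
by rewrite expr0z mul1r addr0.
Qed.

Lemma thompson_set_comp f g :
  thompson_set R f -> thompson_set R g -> thompson_set R (f \o g).
Proof.
move=> [hf fm [sf dsf fs]] [hg gm gpl].
split; [exact: homeomorphism_comp|by move=> x y xy /=; exact/fm/gm|].
have [_ [h [_ gh hg']]] := hg; have [sg dsg gs] := gpl.
pose hb b := \val (h (insubd zeroI b)).
exists (sg ++ [seq hb b | b <- sf]).
  move=> c; rewrite mem_cat => /orP[/dsg//|/mapP[b /dsf db ->]].
  apply/(thompson_dyadic gm hg' gpl); rewrite hg' val_insubd.
  by case: ifP => // _; exact: dyadic0.
move=> a b ab nab.
have [c csg|k [c kc]] := gs a b ab; first by apply: nab; rewrite mem_cat csg.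
have [d dsf'|l [e le]] := fs (g a) (g b) (gm _ _ ab).
  apply/negP => /andP[ad db].
  have d01 : 0 <= d <= 1.
    have /andP[a0 _] := unit_itvP (g a); have /andP[_ b1] := unit_itvP (g b).
    by rewrite (le_trans a0 (ltW ad)) (le_trans (ltW db) b1).
  have ed : \val (insubd zeroI d) = d by rewrite val_insubd (unit_itv_in d01).
  have hbs : hb d \in sg ++ [seq hb b | b <- sf] by rewrite mem_cat map_f ?orbT.
  have /negP[] := nab _ hbs.
  by rewrite /hb -(thompson_mono gm a) -(thompson_mono gm _ b) hg' ed ad.
exists (l + k), (2 ^ l * c + e) => x axb /=.
rewrite le; last by rewrite !(thompson_monole gm).
by rewrite kc// mulrDr mulrA -expfzDr ?pnatr_eq0// addrA.
Qed.

Lemma thompson_set_inv g h : thompson_set R g -> continuous h ->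
  cancel g h -> cancel h g -> thompson_set R h.
Proof.
move=> [[gc _] gm gpl] hc gh hg; have [s ds gs] := gpl.
have hm := thompson_inv_homo gm hg.
split; [by split => //; exists g|exact: hm|].
exists [seq \val (g (insubd zeroI b)) | b <- s].
  move=> c /mapP[b /ds db ->]; apply: (thompson_dyadic gm hg gpl _).1.
  by rewrite val_insubd; case: ifP => // _; exact: dyadic0.
move=> a b ab nab.
have [c cs|k [c kc]] := gs (h a) (h b) (hm _ _ ab).
  apply/negP => /andP[ac cb].
  have c01 : 0 <= c <= 1.
    have /andP[a0 _] := unit_itvP (h a); have /andP[_ b1] := unit_itvP (h b).
    by rewrite (le_trans a0 (ltW ac)) (le_trans (ltW cb) b1).
  have ec : \val (insubd zeroI c) = c by rewrite val_insubd (unit_itv_in c01).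
  have /negP[] := nab _ (map_f (fun b => \val (g (insubd zeroI b))) cs).
  by rewrite -(thompson_mono hm a) -(thompson_mono hm _ b) gh ec ac.
exists (- k), (- (2 ^ (- k) * c)) => x axb.
have := kc (h x); rewrite !(thompson_monole hm) hg => /(_ axb) ->.
by rewrite mulrDr mulrA -expfzDr ?pnatr_eq0// addNr expr0z mul1r addrK.
Qed.

Implicit Types u v w : thompsonF R.

Lemma thompson_inv_ex u : exists v, cancel (\val u) (\val v) /\
  cancel (\val v) (\val u).
Proof.
case: u => g /= gF; have := set_mem gF => -[[gc [h [hc gh hg]]] _ _].
by exists (exist _ h (mem_set (thompson_set_inv (set_mem gF) hc gh hg))).
Qed.

Definition thompson_one : thompsonF R := exist _ id (mem_set thompson_set_id).

Definition thompson_mul u v : thompsonF R :=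
  exist _ (\val u \o \val v)
    (mem_set (thompson_set_comp (set_mem (valP u)) (set_mem (valP v)))).

Definition thompson_inv u : thompsonF R := sval (cid (thompson_inv_ex u)).

Lemma thompson_mulA : associative thompson_mul.
Proof. by move=> u v w; exact: val_inj. Qed.

Lemma thompson_mul1g : left_id thompson_one thompson_mul.
Proof. by move=> u; exact: val_inj. Qed.

Lemma thompson_mulg1 : right_id thompson_one thompson_mul.
Proof. by move=> u; exact: val_inj. Qed.

Lemma thompson_mulVg : left_inverse thompson_one thompson_inv thompson_mul.
Proof.
move=> u; apply/val_inj/funext => x /=; rewrite /thompson_inv.
by case: cid => v /= [uv _]; exact: uv.
Qed.

Lemma thompson_mulgV : right_inverse thompson_one thompson_inv thompson_mul.
Proof.
move=> u; apply/val_inj/funext => x /=; rewrite /thompson_inv.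
by case: cid => v /= [_ vu]; exact: vu.
Qed.

HB.instance Definition _ := isGroup.Build (thompsonF R) thompson_mulA
  thompson_mul1g thompson_mulg1 thompson_mulVg thompson_mulgV.

Lemma thompson_act1 (x : I) : \val (1%g : thompsonF R) x = x.
Proof. by []. Qed.

Lemma thompson_actM u v (x : I) : \val (u * v)%g x = \val u (\val v x).
Proof. by []. Qed.

Definition thompson_action : left_action (thompsonF R) I :=
  LeftAction thompson_act1 thompson_actM.

Lemma half_unit_itv : (2^-1 : R) \in unit_itv R.
Proof. by apply: unit_itv_in; rewrite invr_ge0 ler0n invf_le1 ?ltr0n// ler1n. Qed.

Definition half_pt : I := exist _ 2^-1 half_unit_itv.

End ThompsonGroup.

Arguments thompson_action R : clear implicits.
Arguments half_pt R : clear implicits.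

(* Main.v *)
Require Import Defs.
From HB Require Import structures.
From mathcomp Require Import all_boot all_order all_algebra.
From mathcomp Require Import all_classical all_reals all_analysis.
From mathcomp Require Import ring lra zify.

(** The proof separates a property of the action from a general construction
    of measures.

    The property: every finite set [E] of points of the orbit of [1 / 2] is
    contained in a forward orbit [{g^i p | i in nat}] of one element [g] of
    [F]. Indeed the points of [E] are multiples of a common [d = 2 ^- n] lying
    strictly between [0] and [1], and the element with slope [2] on [[0, d]],
    slope [1] on [[d, 1 - 2 d]] and slope [1 / 2] on [[1 - 2 d, 1]] moves each
    of these multiples, except the last one, to the next
    ([orbit_half_cyclic]). The uniform measure on [1, g, ..., g^(N-1)] then
    sends any two points of [E] to distributions that almost coincide when [N]
    is large ([almost_invariant_powers]).

    The construction: suppose that a countable group acts transitively and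
    that for all finite [E] and [eps] some finitely supported measure moves
    the points of [E] to distributions [eps]-close to each other. Replacing
    the measure [nu] by the convolution of its inverse with [nu] makes it
    symmetric, and a small multiple of any prescribed pair [g, g^-1] can be
    added. Choose such measures [nu_0, nu_1, ...] recursively: [nu_i] is
    [2 ^- i]-invariant on the finite set [K_i] of points reached from the
    first points of an enumeration of the space in at most [4 ^ i] steps
    along the supports of [nu_0, ..., nu_(i-1)]. The measure is
    [mu = sum_i 2 ^- i.+1 * nu_i].

    To see that a bounded harmonic function [f] is constant, fix [i] and write
    [f = A f + B f], where [A] gathers the indices below [i], of total weight
    [1 - 2 ^- i], and [B] the others. The function [B f] oscillates little on
    [K_i], and [A f] oscillates on a set of starting points at most
    [1 - 2 ^- i] times as much as [f] does one step further. Iterating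
    [4 ^ i] times bounds the oscillation of [f] on the starting points by
    [2 M (1 - 2 ^- i) ^ (4 ^ i) + 2 ^- i M <= 3 M 2 ^- i]
    ([oscillation_bound], [mixture_liouville]). Letting [i] grow gives the
    result. Finally [F] is countable, because an element is determined by its
    breakpoints and its values there, which are dyadic ([thompson_enum]). *)

Set Implicit Arguments.
Unset Strict Implicit.
Unset Printing Implicit Defensive.

Import Order.TTheory GRing.Theory Num.Theory numFieldNormedType.Exports.

Local Open Scope classical_set_scope.
Local Open Scope ring_scope.

(** * Sums, averages over lists, and mixtures *)

Section Esum.
Context (R : realType).
Local Open Scope ereal_scope.

(** Tonelli's theorem for sums. *)
Lemma esum_exchange (I J : choiceType) (a : I -> J -> \bar R) :
  (forall i j, 0 <= a i j) ->
  \esum_(i in [set: I]) \esum_(j in [set: J]) a i j =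
  \esum_(j in [set: J]) \esum_(i in [set: I]) a i j.
Proof.
move=> a0; rewrite !esum_esum//.
rewrite (reindex_esum ([set: J] `*`` fun=> [set: I]) _ (fun k => (k.2, k.1)))//.
split=> [k _ //|k k' _ _|[i j] _]; last by exists (j, i).
by case: k k' => [? ?] [? ?] /= [-> ->].
Qed.

Lemma esumZl_nat (c : R) (a : nat -> \bar R) : (0 <= c)%R ->
  (forall j, 0 <= a j) ->
  (c%:E * (\esum_(j in [set: nat]) a j) =
   \esum_(j in [set: nat]) (c%:E * a j))%E.
Proof.
move=> c0 a0; rewrite -!nneseries_esumT//; last by move=> j; rewrite mule_ge0.
by rewrite nneseriesZl.
Qed.

Lemma esum_point (Y : choiceType) (b : Y -> R) (y : Y) : (0 <= b y)%R ->
  \esum_(z in [set: Y]) (b z * (y == z)%:R)%:E = (b y)%:E.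
Proof.
move=> b0; rewrite -[RHS](@esum_set1 _ _ y (EFin \o b))// [RHS]esum_mkcond.
apply: eq_esum => z _ /=; case: (eqVneq y z) => [->|yz].
  by rewrite mulr1 mem_set.
by rewrite mulr0 memNset// => /esym/eqP; rewrite (negbTE yz).
Qed.

End Esum.

Section Average.
Context (R : realType) (G : eqType).
Implicit Types (l : seq G) (F : G -> R).

(** The mean of [F] over the list [l], counted with multiplicity; it is [0]
    on the empty list. *)
Definition avg l F : R := (\sum_(g <- l) F g) / (size l)%:R.

Lemma avg_ge0 l F : (forall g, 0 <= F g) -> 0 <= avg l F.
Proof. by move=> F0; rewrite divr_ge0// sumr_ge0. Qed.

Lemma avgB l F F' : avg l (fun g => F g - F' g) = avg l F - avg l F'.
Proof. by rewrite /avg sumrB mulrBl. Qed.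

Lemma avgZ l (c : R) F : avg l (fun g => c * F g) = c * avg l F.
Proof. by rewrite /avg -mulr_sumr mulrA. Qed.

Lemma avg1 l : l != [::] -> avg l (fun=> 1) = 1.
Proof.
move=> l0; rewrite /avg big_const_seq count_predT iter_addr_0 divff//.
by rewrite pnatr_eq0 size_eq0.
Qed.

End Average.

Lemma ler_avg (R : realType) (G : eqType) (l : seq G) (F F' : G -> R) :
  {in l, forall g, F g <= F' g} -> avg l F <= avg l F'.
Proof.
move=> FF'; rewrite ler_wpM2r// big_seq [leRHS]big_seq.
by apply: ler_sum => g /FF'.
Qed.

Lemma avg_bound (R : realType) (G : eqType) (l : seq G) (F : G -> R) (D : R) :
  0 <= D -> {in l, forall g, `|F g| <= D} -> `|avg l F| <= D.
Proof.
move=> D0 FD; case: (eqVneq l [::]) => [->|l0].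
  by rewrite /avg big_nil mul0r normr0.
rewrite -[D]mulr1 -(avg1 R l0) -avgZ ler_norml.
rewrite -mulN1r -avgZ; apply/andP; split; apply: ler_avg => g /FD;
 by rewrite ler_norml ?mulN1r mulr1 => /andP[].
Qed.

(** The sum of [h] against the pushforward by [phi] of the uniform measure on
    the list [l]. *)
Lemma esum_avg (R : realType) (G Y : choiceType) (phi : G -> Y) (l : seq G)
    (h : Y -> R) : (forall y, 0 <= h y) ->
  (\esum_(y in [set: Y]) (h y * avg l (fun g => (phi g == y)%:R))%:E =
  (avg l (h \o phi))%:E)%E.
Proof.
move=> h0.
transitivity (\esum_(y in [set: Y]) \sum_(g <- l)
    (((size l)%:R^-1 * h y) * (phi g == y)%:R)%:E)%E.
  apply: eq_esum => y _; rewrite sumEFin; congr EFin.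
  rewrite -mulr_sumr /avg; ring.
rewrite esum_sum; last by move=> *; rewrite lee_fin !mulr_ge0.
rewrite (eq_bigr (fun g => ((size l)%:R^-1 * h (phi g))%:E)); last first.
  by move=> g _; 
  rewrite (esum_point (b := fun y => (size l)%:R^-1 * h y))// mulr_ge0.
by rewrite sumEFin -mulr_sumr mulrC.
Qed.

(** The weights [2 ^- j.+1], of total mass [1]. *)
Definition wt (R : realType) (j : nat) : R := 2^-1 ^+ j.+1.

Lemma wt_ge0 (R : realType) j : 0 <= wt R j.
Proof. by rewrite exprn_ge0// invr_ge0. Qed.

Lemma sum_wt (R : realType) n : \sum_(0 <= j < n) wt R j = 1 - 2^-1 ^+ n.
Proof.
elim: n => [|n IH]; first by rewrite big_geq// expr0 subrr.
rewrite big_nat_recr//= IH /wt exprS; lra.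
Qed.

Section Mixture.
Context (R : realType) (G : choiceType) (l : nat -> seq G).
Implicit Types (F : G -> R).
Local Notation wt := (wt R).

(** Integral of a nonnegative [F] against the measure which draws an index
    [j] with probability [2 ^- j.+1], then a uniform entry of the list [l j]. *)
Definition mixE F : \bar R :=
  (\esum_(j in [set: nat]) (wt j * avg (l j) F)%:E)%E.

(** The same integral as a real number; finite when [F] is bounded, by
    [mix_cvg]. *)
Definition mixture F : R := fine (mixE F).

(** For a bounded nonnegative [F] the integral is the limit of its partial
    sums. *)
Lemma mix_cvg F (M : R) : (forall g, 0 <= F g <= M) ->
  mixE F \is a fin_num /\
  (fun n => \sum_(0 <= j < n) wt j * avg (l j) F) @ \oo --> mixture F.
Proof.
move=> FM; have F0 g : 0 <= F g by have /andP[] := FM g.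
(* If [G] is empty then [M] need not be nonnegative, but all averages vanish. *)
case: (pselect (exists g : G, True)) => [[g0 _]|noG]; last first.
  have z j : wt j * avg (l j) F = 0.
    case: (l j) => [|g ?]; first by rewrite /avg big_nil mul0r mulr0.
    by exfalso; apply: noG; exists g.
  have e0 : mixE F = 0%E by apply: esum1 => j _; rewrite z.
  split; first by rewrite e0.
  rewrite /mixture e0 /= (_ : (fun _ => _) = fun=> 0); first exact: cvg_cst.
  by apply/funext => n; rewrite big1// => j _; rewrite z.
have M0 : 0 <= M by have /andP[/le_trans] := FM g0; apply.
pose u n := \sum_(0 <= j < n) wt j * avg (l j) F.
have t0 j : 0 <= wt j * avg (l j) F by rewrite mulr_ge0 ?wt_ge0 ?avg_ge0.
have nd : nondecreasing_seq u by apply: (nondecreasing_series (P := xpredT)).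
have ub n : u n <= M.
  apply: (@le_trans _ _ (\sum_(0 <= j < n) wt j * M)).
    apply: ler_sum => j _; rewrite ler_wpM2l ?wt_ge0//.
    apply: le_trans (ler_norm _) _; apply: avg_bound => // g _.
    by rewrite ger0_norm//; have /andP[] := FM g.
  by rewrite -mulr_suml sum_wt ler_piMl// gerBl exprn_ge0// invr_ge0.
have cu : cvgn u by apply: nondecreasing_is_cvgn => //; exists M => _ [n _ <-].
have e : mixE F = (limn u)%:E.
  rewrite /mixE -nneseries_esumT; last by move=> j; rewrite lee_fin.
  rewrite -EFin_lim//; congr (lim (_ @ \oo)); apply/funext => n.
  by rewrite /u /= sumEFin.
by split; rewrite /mixture e.
Qed.

Lemma mixE_ge0 F : (forall g, 0 <= F g) -> (0 <= mixE F)%E.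
Proof.
by move=> F0; apply: esum_ge0 => j _; rewrite lee_fin mulr_ge0 ?wt_ge0 ?avg_ge0.
Qed.

(** Change of variables for the pushforward of the mixture under [phi]. *)
Lemma esum_mixture (Y : choiceType) (phi : G -> Y) (h : Y -> R) (M : R) :
  (forall y, 0 <= h y <= M) ->
  (\esum_(y in [set: Y]) (h y * mixture (fun g => (phi g == y)%:R))%:E =
  (mixture (h \o phi))%:E)%E.
Proof.
move=> hM; have h0 y : 0 <= h y by have /andP[] := hM y.
rewrite /mixture fineK; last by apply: (mix_cvg (M := M) _).1 => g; exact: hM.
under eq_esum => y _.
  rewrite EFinM fineK; last first.
    by apply: (mix_cvg (M := 1) _).1 => g; case: eqP; rewrite !lexx ler01.
  rewrite esumZl_nat//; last first.
    by move=> j; rewrite lee_fin mulr_ge0 ?wt_ge0 ?avg_ge0.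
  over.
rewrite esum_exchange; last first.
  by move=> y j; rewrite mule_ge0// lee_fin// mulr_ge0 ?wt_ge0 ?avg_ge0.
apply: eq_esum => j _.
rewrite -avgZ; have /= <- := @esum_avg R _ _ phi (l j) (fun y => wt j * h y).
  by apply: eq_esum => y _; rewrite -EFinM; congr EFin; ring.
by move=> y; rewrite mulr_ge0 ?wt_ge0.
Qed.

End Mixture.

(** * Random walks driven by mixtures of uniform measures *)

Lemma ind01 (R : realType) (b : bool) : 0 <= (b%:R : R) <= 1.
Proof. by case: b; rewrite !lexx ler01. Qed.

Section MixtureMeasure.
Context (R : realType) (G : groupType) (l : nat -> seq G).

(** The point masses of the mixture of the uniform measures on the lists. *)
Definition mixture_mass (g : G) : R := mixture l (fun h => (h == g)%:R).

Lemma mixture_mass_ge0 g : 0 <= mixture_mass g.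
Proof. by apply/fine_ge0/mixE_ge0. Qed.

Lemma mixture_mass_prob : (forall j, l j != [::]) -> prob_measure mixture_mass.
Proof.
move=> l0; split; first exact: mixture_mass_ge0.
have b1 (g : G) : 0 <= (1 : R) <= 1 by rewrite lexx ler01.
have := esum_mixture l (@id G) b1.
under eq_esum do rewrite mul1r.
move=> ->; congr EFin.
have [_ /cvg_lim <- //] := mix_cvg l b1.
apply/cvg_lim => //; under eq_fun do
  (under eq_bigr do rewrite avg1// mulr1; rewrite sum_wt).
rewrite -[X in nbhs X]subr0; apply: cvgB; first exact: cvg_cst.
by apply: cvg_expr; rewrite ger0_norm ?invr_ge0// invf_lt1 ?ltr0n// ltr1n.
Qed.

Lemma mixture_mass_sym : (forall j, perm_eq (l j) [seq g^-1%g | g <- l j]) ->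
  symmetric_measure mixture_mass.
Proof.
move=> ls g; congr fine; apply: eq_esum => j _; congr (_ * _)%:E.
rewrite /avg; congr (_ / _); rewrite (perm_big _ (ls j)) big_map /=.
by apply: eq_bigr => h _; rewrite (can2_eq (@invgK G) (@invgK G)).
Qed.

Lemma mixture_mass_gt0 j g : g \in l j -> 0 < mixture_mass g.
Proof.
move=> gl; rewrite -lte_fin fineK; last first.
  by apply: (mix_cvg l (M := 1) _).1 => h; exact: ind01.
rewrite /mixE (esumID [set j]); last first.
  by move=> i _; rewrite lee_fin mulr_ge0 ?wt_ge0 ?avg_ge0.
rewrite setTI esum_set1; last by rewrite lee_fin mulr_ge0 ?wt_ge0 ?avg_ge0.
apply: (@lt_le_trans _ _ (wt R j * avg (l j) (fun h => (h == g)%:R))%:E);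
  last first.
  rewrite leeDl// esum_ge0// => i _.
  by rewrite lee_fin mulr_ge0 ?wt_ge0 ?avg_ge0.
rewrite lte_fin mulr_gt0//; first by rewrite exprn_gt0// invr_gt0.
have lj0 : (0 < size (l j))%N by case: (l j) gl.
rewrite divr_gt0 ?ltr0n//; rewrite (big_rem g)//= eqxx.
by rewrite ltr_wpDr// sumr_ge0.
Qed.

Context (X : choiceType) (a : left_action G X).

Lemma transition_mixture x y :
  transition a mixture_mass x y = mixture l (fun g => (a g x == y)%:R).
Proof.
have b (g : G) : 0 <= ((a g x == y)%:R : R) <= 1 by exact: ind01.
rewrite /transition esum_mkcond.
have := esum_mixture l (@id G) b => /= e.
rewrite (_ : esum _ _ = (mixture l (fun g => (a g x == y)%:R))%:E)// -e.
apply: eq_esum => g _; case: eqP => [h|h].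
  by rewrite mem_set// mul1r.
by rewrite memNset// mul0r.
Qed.

(** For a bounded function, harmonicity says that [f x] is the convergent series
    of the weighted averages of [f] over the points [a g x], [g] in [l j]. *)
Lemma harmonic_mixture (f : X -> R) (M : R) : (forall x, `|f x| <= M) ->
  harmonic_fun a mixture_mass f -> forall x,
  (fun n => \sum_(0 <= j < n) wt R j * avg (l j) (fun g => f (a g x))) @ \oo
    --> f x.
Proof.
move=> fM fH x; have [_ fx] := fH x.
(* The change of variables applies to the positive and negative parts. *)
pose fp y := Num.max (f y) 0; pose fn y := Num.max (- f y) 0.
have M0 : 0 <= M by apply: le_trans (fM x).
have fpM y : 0 <= fp y <= M.
  rewrite /fp le_max lexx orbT ge_max M0 andbT.
  by have := fM y; rewrite ler_norml => /andP[].
have fnM y : 0 <= fn y <= M.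
  rewrite /fn le_max lexx orbT ge_max M0 andbT.
  by have := fM y; rewrite ler_norml lerNl => /andP[].
have tr0 y : 0 <= transition a mixture_mass x y.
  by rewrite transition_mixture; apply/fine_ge0/mixE_ge0.
have ep := esum_mixture l (fun g => a g x) fpM.
have en := esum_mixture l (fun g => a g x) fnM.
have [_ cp] := mix_cvg l (fun g => fpM (a g x)).
have [_ cn] := mix_cvg l (fun g => fnM (a g x)).
have fxE : f x = mixture l (fp \o a^~ x) - mixture l (fn \o a^~ x).
  apply: EFin_inj; rewrite fx EFinB -ep -en; congr (_ - _)%E;
    apply: eq_esum => y _.
  - by rewrite funeposE -EFin_max -transition_mixture /fp maxr_pMl// mul0r.
  - rewrite funenegE -EFinN -EFin_max -transition_mixture /fn maxr_pMl//.
    by rewrite mul0r mulNr.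
rewrite fxE (_ : (fun n => _) = (fun n =>
  \sum_(0 <= j < n) wt R j * avg (l j) (fp \o a^~ x) -
  \sum_(0 <= j < n) wt R j * avg (l j) (fn \o a^~ x))); first exact: cvgB.
apply/funext => n; rewrite -sumrB; apply: eq_bigr => j _.
rewrite -mulrBr -avgB; congr (_ * _); congr avg; apply/funext => g /=.
rewrite /fp /fn; case/orP: (le_total 0 (f (a g x))) => h.
  by rewrite max_l// max_r ?oppr_le0// subr0.
by rewrite max_r// max_l ?oppr_ge0// sub0r opprK.
Qed.

End MixtureMeasure.

(** * Almost invariant lists *)

Section AlmostInvariant.
Context (R : realType) (G : groupType) (X : choiceType) (a : left_action G X).
Implicit Types (l : seq G) (E : seq X) (eps : R).

(** The uniform measure on the list [l] sends any two points of [E] to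
    distributions on [X] at distance at most [eps] in total variation, tested
    here against bounded functions. *)
Definition almost_invariant l E eps : Prop :=
  forall (f : X -> R) (M : R), (forall x, `|f x| <= M) ->
    {in E &, forall x y,
      `|avg l (fun g => f (a g x)) - avg l (fun g => f (a g y))| <= eps * M}.

Lemma almost_invariant_sub l E E' eps eps' : {subset E <= E'} -> eps' <= eps ->
  almost_invariant l E' eps' -> almost_invariant l E eps.
Proof.
move=> EE' ee lE f M fM x y xE yE; apply: le_trans (lE f M fM x y _ _) _.
- exact: EE'.
- exact: EE'.
by rewrite ler_wpM2r// (le_trans _ (fM x)).
Qed.

(** The list of the products [g^-1 h]: the convolution of the inverse of the
    uniform measure on [l] with that measure. *)
Definition sym_list l := [seq (g^-1 * h)%g | g <- l, h <- l].

Lemma perm_sym_list l : perm_eq (sym_list l) [seq g^-1%g | g <- sym_list l].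
Proof.
apply/permP => p; rewrite /sym_list map_allpairs.
rewrite -!sum1_count big_mkcond [RHS]big_mkcond !big_allpairs_dep.
rewrite exchange_big /=.
by apply: eq_bigr => g _; apply: eq_bigr => h _; rewrite invgM invgK.
Qed.

Lemma avg_sym_list l (F : G -> R) :
  avg (sym_list l) F = avg l (fun g => avg l (fun h => F (g^-1 * h)%g)).
Proof.
by rewrite /avg size_allpairs big_allpairs_dep -mulr_suml natrM invfM mulrA.
Qed.

(** The symmetrized measure inherits the bound, since the last convolution
    factor applied only averages functions on [X] with the same bound. *)
Lemma almost_invariant_sym l E eps : 0 <= eps ->
  almost_invariant l E eps -> almost_invariant (sym_list l) E eps.
Proof.
move=> e0 lE f M fM x y xE yE; rewrite !avg_sym_list -avgB.
apply: avg_bound => [|g _]; first by rewrite mulr_ge0// (le_trans _ (fM x)).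
have act2 z : (fun h => f (a (g^-1 * h)%g z)) = (fun h => f (a g^-1%g (a h z))).
  by apply/funext => h; rewrite actM.
by rewrite !act2; apply: (lE (fun z => f (a g^-1%g z))).
Qed.

(** Any [g] can be added: repeat [l] so often that the two extra entries [g] and
    [g^-1] have small weight. *)
Lemma almost_invariant_mem l E eps (g : G) : l != [::] ->
  perm_eq l [seq g^-1%g | g <- l] -> 0 < eps -> almost_invariant l E eps ->
  exists l', [/\ g \in l', perm_eq l' [seq g^-1%g | g <- l'] &
    almost_invariant l' E (2 * eps)].
Proof.
move=> l0 ls e0 lE.
have [k kP] : exists k : nat, 4 <= eps * k%:R.
  exists (Num.truncn (4 / eps)).+1.
  by rewrite mulrC -ler_pdivrMr// ltW// truncnS_gt.
pose l' := flatten (nseq k l) ++ [:: g; g^-1%g].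
exists l'; split.
- by rewrite mem_cat mem_head orbT.
- rewrite /l' map_cat /= invgK perm_cat//; last first.
    by rewrite (perm_catC [:: g] [:: _]).
  rewrite map_flatten map_nseq; elim: k {kP l'} => //= k IH.
  exact: perm_cat.
move=> f M fM x y xE yE.
have M0 : 0 <= M by apply: le_trans (fM x).
have S F : avg l' F = (k%:R * (size l)%:R * avg l F + F g + F g^-1%g) /
    (k%:R * (size l)%:R + 2).
  rewrite /avg; congr (_ / _).
    rewrite big_cat /= big_cons big_seq1 addrA; congr (_ + _ + _).
    rewrite -mulrA [_ * (_ / _)]mulrC divfK ?pnatr_eq0 ?size_eq0//.
    rewrite big_flatten /= big_nseq; elim: k {kP l'} => [|k IH] /=.
      by rewrite mul0r.
    by rewrite IH -[k.+1]add1n natrD; ring.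
  rewrite size_cat size_flatten /shape map_nseq sumn_nseq natrD natrM.
  by rewrite mulrC.
rewrite !S -mulrBl normrM normfV; set N := k%:R * (size l)%:R.
have sz : 1 <= (size l)%:R :> R by rewrite ler1n; case: (l) l0.
have Nk : k%:R <= N by rewrite /N ler_peMr.
have N0 : 0 <= N by apply: le_trans Nk.
rewrite [`|N + 2|]ger0_norm ?addr_ge0// ler_pdivrMr ?ltr_wpDl//.
have := lE f M fM x y xE yE; set A := avg _ _; set B := avg _ _ => AB.
have fg z := fM (a g z); have fg' z := fM (a g^-1%g z).
rewrite (_ : _ - _ = N * (A - B) + (f (a g x) - f (a g y)) +
  (f (a g^-1%g x) - f (a g^-1%g y))); last by ring.
apply: (@le_trans _ _ (N * (eps * M) + (M + M) + (M + M))).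
  rewrite (le_trans (ler_normD _ _))// lerD//.
    rewrite (le_trans (ler_normD _ _))// lerD//.
      by rewrite normrM ger0_norm// ler_wpM2l.
    by rewrite (le_trans (ler_normB _ _))// lerD.
  by rewrite (le_trans (ler_normB _ _))// lerD.
have : 4 <= eps * N by apply: le_trans kP _; rewrite ler_wpM2l// ltW.
nra.
Qed.

End AlmostInvariant.

(** * Recursive construction of a Liouville measure *)

(** A consequence of Bernoulli's inequality: with [t = 2 ^- i], the number
    [4 ^ i * t] is [t^-1], so [(1 - t) ^ (4 ^ i) <= (1 + 4 ^ i * t)^-1 <= t]. *)
Lemma geometric_bound (R : realType) i :
  (1 - 2^-1 ^+ i) ^+ (4 ^ i) <= 2^-1 ^+ i :> R.
Proof.
set t : R := 2^-1 ^+ i.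
have t0 : 0 < t by rewrite exprn_gt0// invr_gt0.
have t1 : t <= 1 by rewrite exprn_ile1 ?invr_ge0// invf_le1 ?ltr0n// ler1n.
have B (n : nat) : 1 + n%:R * t <= (1 + t) ^+ n.
  elim: n => [|n IH]; first by rewrite mul0r addr0 expr0.
  rewrite exprS; apply: le_trans (ler_wpM2l _ IH); last lra.
  have n0 : 0 <= n%:R :> R by [].
  rewrite -[n.+1]add1n natrD; nra.
have N : (4 ^ i)%:R * t = t^-1.
  rewrite /t natrX -exprVn invrK -exprMn; congr (_ ^+ _).
  by rewrite (_ : 4 = 2 * 2) ?natrM ?mulfK -?natrM.
have p0 : 0 <= (1 - t) ^+ (4 ^ i) by rewrite exprn_ge0// subr_ge0.
have h : (1 - t) ^+ (4 ^ i) * t^-1 <= 1.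
  apply: (@le_trans _ _ ((1 - t) ^+ (4 ^ i) * (1 + t) ^+ (4 ^ i))).
    by rewrite ler_wpM2l// -N (le_trans _ (B _))// lerDr.
  rewrite -exprMn exprn_ile1//; nra.
by rewrite -[leRHS]mul1r -ler_pdivrMr.
Qed.

Section Hull.
Context (G : groupType) (X : choiceType) (a : left_action G X).
Implicit Types (S : seq G) (E : seq X).

(** The points reached from [E] in at most [n] steps, each by an entry
    of [S]. *)
Definition hull S E n :=
  iter n (fun E => E ++ [seq a g x | g <- S, x <- E]) E.

Lemma hullW S E m n : (m <= n)%N -> {subset hull S E m <= hull S E n}.
Proof.
move=> /subnKC <-; elim: (n - m)%N => [|k IH] x xm; first by rewrite addn0.
by rewrite addnS /= mem_cat IH.
Qed.

Lemma hull_step S E n g x :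
  g \in S -> x \in hull S E n -> a g x \in hull S E n.+1.
Proof.
by move=> gS xE; rewrite /= mem_cat orbC allpairs_f.
Qed.

Lemma hull_sub S S' E E' n : {subset S <= S'} -> {subset E <= E'} ->
  {subset hull S E n <= hull S' E' n}.
Proof.
move=> SS EE; elim: n => //= n IH x; rewrite !mem_cat => /orP[/IH->//|].
case/allpairsP=> -[g y] /= [gS yE ->]; apply/orP; right.
by apply: allpairs_f; [exact: SS|exact: IH].
Qed.

End Hull.

Section Construction.
Context (R : realType) (G : groupType) (X : choiceType) (a : left_action G X).
Context (e : nat -> G) (x0 : X).
Context (e_surj : forall g, exists n, e n = g).
Context (a_trans : forall x, exists g, a g x0 = x).
Context (invH : forall (E : seq X) (eps : R), 0 < eps ->
  exists l, l != [::] /\ almost_invariant a l E eps).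

Let delta i : R := 2^-1 ^+ i.

Let delta_gt0 i : 0 < delta i.
Proof. by rewrite exprn_gt0// invr_gt0. Qed.

Lemma step_exists (E : seq X) i : exists l, [/\ e i \in l,
  perm_eq l [seq g^-1%g | g <- l] & almost_invariant a l E (delta i)].
Proof.
have d0 : 0 < delta i / 2 by rewrite divr_gt0.
have [l [l0 lE]] := invH E d0.
have [||||l' [el' sl' lE']] :=
  @almost_invariant_mem R G X a (sym_list l) E (delta i / 2) (e i).
- by rewrite -size_eq0 size_allpairs muln_eq0 size_eq0 (negbTE l0).
- exact: perm_sym_list.
- by [].
- by apply: almost_invariant_sym lE; exact: ltW.
exists l'; split => //; apply: almost_invariant_sub lE' => //.
by rewrite mulrC divfK.
Qed.

(** A symmetric list containing [e i] and [2 ^- i]-invariant on [E]. *)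
Definition step E i : seq G := sval (cid (step_exists E i)).

(** The first [i.+1] points in the enumeration of [X] induced by [e]. *)
Definition start i : seq X := [seq a (e k) x0 | k <- iota 0 i.+1].

(** [prior i] collects the entries of the lists of index less than [i]. *)
Fixpoint prior i : seq G :=
  if i is j.+1 then
    prior j ++ step (hull a (prior j) (start j) (4 ^ j)) j
  else [::].

(** The support, with multiplicities, of the [i]-th measure of the mixture. *)
Definition layer i : seq G := step (hull a (prior i) (start i) (4 ^ i)) i.

Lemma layerP i : [/\ e i \in layer i,
  perm_eq (layer i) [seq g^-1%g | g <- layer i] &
  almost_invariant a (layer i) (hull a (prior i) (start i) (4 ^ i)) (delta i)].
Proof. by rewrite /layer /step; case: cid. Qed.

Lemma layer_neq0 i : layer i != [::].
Proof. by have [] := layerP i; case: (layer i). Qed.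

Lemma prior_sub i j : (i <= j)%N -> {subset prior i <= prior j}.
Proof.
move=> /subnKC <-; elim: (j - i)%N => [|k IH] g gi; first by rewrite addn0.
by rewrite addnS /= mem_cat IH.
Qed.

Lemma layer_prior i j : (j < i)%N -> {subset layer j <= prior i}.
Proof.
by move=> /prior_sub ji g gj; apply: ji; rewrite /= mem_cat -/(layer j) gj orbT.
Qed.

Lemma start_sub i j : (i <= j)%N -> {subset start i <= start j}.
Proof.
move=> ij _ /mapP[k + ->]; rewrite mem_iota => ki.
apply: (map_f (fun k => a (e k) x0)).
by rewrite mem_iota; lia.
Qed.

(** The sets on which invariance is imposed increase with the index, so the
    lists of index at least [i] are all [2 ^- i]-invariant on the [i]-th one. *)
Lemma layer_invariant i j : (i <= j)%N ->
  almost_invariant a (layer j) (hull a (prior i) (start i) (4 ^ i)) (delta i).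
Proof.
move=> ij; have [_ _] := layerP j; apply: almost_invariant_sub.
  move=> x /(hull_sub (prior_sub ij) (start_sub ij)); apply: hullW.
  by rewrite leq_exp2l.
by rewrite /delta ler_wiXn2l ?invr_ge0// invf_le1 ?ltr0n// ler1n.
Qed.

Let mu : G -> R := mixture_mass R layer.

(** With [n] steps still available among the [4 ^ i] used to define the [i]-th
    set, the part of the walk with indices below [i] contributes a factor
    [1 - 2 ^- i] per step, and the part with indices at least [i] contributes
    altogether at most [2 ^- i * M]. *)
Lemma oscillation_bound (f : X -> R) (M : R) i : (forall x, `|f x| <= M) ->
  harmonic_fun a mu f -> forall n m, (m + n <= 4 ^ i)%N ->
  {in hull a (prior i) (start i) m &, forall x y,
    `|f x - f y| <= 2 * M * (1 - delta i) ^+ n + delta i * M}.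
Proof.
move=> fM fH; elim=> [|n IH] m mn x y xm ym.
  have M0 : 0 <= M by apply: le_trans (fM x).
  rewrite expr0 mulr1 (le_trans (ler_normB _ _))//.
  have := fM x; have := fM y; have := mulr_ge0 (ltW (delta_gt0 i)) M0; lra.
have M0 : 0 <= M by apply: le_trans (fM x).
have d1 : delta i <= 1.
  by rewrite exprn_ile1 ?invr_ge0// invf_le1 ?ltr0n// ler1n.
pose D := 2 * M * (1 - delta i) ^+ n.
have D0 : 0 <= D by rewrite !mulr_ge0// exprn_ge0// subr_ge0.
have dM0 : 0 <= delta i * M by rewrite mulr_ge0// ltW.
(* [b j] is the contribution of index [j], before weighting: below [i] one
   more step has been made, from [i] on the list is almost invariant. *)
pose b j := `|avg (layer j) (fun g => f (a g x)) -
  avg (layer j) (fun g => f (a g y))|.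
have b_lt j : (j < i)%N -> b j <= D + delta i * M.
  move=> ji; rewrite /b -avgB; apply: avg_bound; first exact: addr_ge0.
  move=> g /(layer_prior ji) gp; apply: (IH m.+1); first by rewrite addSnnS.
  - exact: hull_step.
  - exact: hull_step.
have b_ge j : (i <= j)%N -> b j <= delta i * M.
  move=> ij; apply: (layer_invariant ij fM).
    by apply: hullW xm; lia.
  by apply: hullW ym; lia.
have key N : (i <= N)%N ->
  `|\sum_(0 <= j < N) wt R j * avg (layer j) (fun g => f (a g x)) -
    \sum_(0 <= j < N) wt R j * avg (layer j) (fun g => f (a g y))| <=
   D * (1 - delta i) + delta i * M.
  move=> iN; rewrite -sumrB; apply: (le_trans (ler_norm_sum _ _ _)).
  apply: (@le_trans _ _ (\sum_(0 <= j < N) wt R j * b j)).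
    by apply: ler_sum => j _; rewrite -mulrBr normrM ger0_norm ?wt_ge0.
  rewrite (@big_cat_nat _ _ _ i)//=.
  apply: (@le_trans _ _ (\sum_(0 <= j < i) wt R j * (D + delta i * M) +
     \sum_(i <= j < N) wt R j * (delta i * M))).
    rewrite lerD// [leLHS]big_nat [leRHS]big_nat;
      apply: ler_sum => j /andP[ij ji];
      by rewrite ler_wpM2l ?wt_ge0 ?b_lt ?b_ge.
  rewrite -!mulr_suml mulrDr -addrA -mulrDl.
  rewrite -(@big_cat_nat _ _ _ i)//=.
  rewrite !sum_wt -/(delta i) mulrC lerD2l// ler_piMl// gerBl ltW.
have cx := @harmonic_mixture R G layer X a f M fM fH x.
have cy := @harmonic_mixture R G layer X a f M fM fH y.
apply: (cvgr_to_le (cvg_norm (cvgB cx cy))); exists i => // N /= iN.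
by rewrite exprSr mulrA; exact: key.
Qed.

(** Each point lies in [start i] for all large [i], so the oscillation bound with
    [n = 4 ^ i] applies to any pair of points. *)
Lemma mixture_liouville : liouville a mu.
Proof.
move=> f /pinfty_ex_gt0[M M0 fM] fH; exists (f x0) => x.
have {}fM z : `|f z| <= M by exact: fM.
have [g gx] := a_trans x; have [k ek] := e_surj g.
have [k0 ek0] := e_surj 1%g.
have startP i n : (n <= i)%N -> a (e n) x0 \in start i.
  by move=> ni; apply: (map_f (fun k => a (e k) x0)); rewrite mem_iota.
have small i : (k + k0 <= i)%N -> `|f x - f x0| <= 3 * M * delta i.
  move=> ki.
  have xi : x \in hull a (prior i) (start i) 0.
    by rewrite -gx -ek startP// (leq_trans _ ki)// leq_addr.
  have x0i : x0 \in hull a (prior i) (start i) 0.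
    by rewrite -[x0](act1 a) -ek0 startP// (leq_trans _ ki)// leq_addl.
  have := @oscillation_bound f M i fM fH (4 ^ i)%N 0%N (leqnn _) _ _ xi x0i.
  move=> /le_trans; apply.
  have := geometric_bound R i; rewrite -/(delta i); nra.
apply/eqP; rewrite -subr_eq0 -normr_le0 leNgt; apply/negP => t0.
set t := `|_| in small t0.
have [n nP] : exists n : nat, 3 * M < n%:R * t.
  by exists (Num.truncn (3 * M / t)).+1; rewrite -ltr_pdivrMr// truncnS_gt.
have := small (k + k0 + n)%N (leq_addr _ _); apply/negP; rewrite -ltNge.
rewrite /delta exprVn -[_ / _]/(_ * _^-1) ltr_pdivrMr ?exprn_gt0//.
apply: lt_le_trans nP _; rewrite mulrC ler_pM2l// -natrX ler_nat.
by rewrite (leq_trans (leq_addl (k + k0) n))// ltnW// ltn_expl.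
Qed.

End Construction.

(** * Actions with almost invariant lists *)

(** A transitive action of a countable group with almost invariant lists carries
    a Liouville measure, whose support is even the whole group. *)
Lemma exists_liouville_measure (R : realType) (G : groupType) (X : choiceType)
    (a : left_action G X) (e : nat -> G) (x0 : X) :
  (forall g, exists n, e n = g) -> (forall x, exists g, a g x0 = x) ->
  (forall (E : seq X) (eps : R), 0 < eps ->
    exists l, l != [::] /\ almost_invariant a l E eps) ->
  exists mu : G -> R, [/\ prob_measure mu, nondegenerate_measure mu,
    symmetric_measure mu & liouville a mu].
Proof.
move=> e_surj a_trans invH; pose l := layer e x0 invH.
have lP i : [/\ e i \in l i, perm_eq (l i) [seq g^-1%g | g <- l i]
  & l i != [::]].
  by split; have [] := layerP e x0 invH i => // _ _ _; exact: layer_neq0.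
exists (mixture_mass R l); split.
- by apply: mixture_mass_prob => i; have [] := lP i.
- apply/seteqP; split => // g _ H [_ +]; apply.
  have [n <-] := e_surj g.
  by apply: (@mixture_mass_gt0 _ _ _ n); have [] := lP n.
- by apply: mixture_mass_sym => i; have [] := lP i.
- exact: mixture_liouville.
Qed.

(** The sum over a segment changes by at most [2 * M] when the segment moves by
    one. *)
Lemma sum_shift_bound (R : realType) (u : nat -> R) (M : R) N k :
  (forall i, `|u i| <= M) ->
  `|\sum_(0 <= i < N) u (i + k)%N - \sum_(0 <= i < N) u i| <= 2 * k%:R * M.
Proof.
move=> uM; elim: k => [|k IH].
  by under eq_bigr do rewrite addn0; rewrite subrr normr0 mulr0 mul0r.
set S := \sum_(0 <= i < N) u (i + k)%N in IH.
rewrite -(subrKA S) (le_trans (ler_normD _ _))//.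
rewrite -[k.+1]add1n natrD mulrDr mulrDl lerD// mulr1 -sumrB.
under eq_bigr do rewrite addnS -addSn.
rewrite (telescope_sumr (fun i => u (i + k)%N))//.
rewrite (le_trans (ler_normB _ _))//.
have := uM (N + k)%N; have := uM (0 + k)%N; lra.
Qed.

(** If [E] is contained in the orbit of [p] under the powers of [g], the list
    [1, g, ..., g ^+ N.-1] is almost invariant for large [N]: its images of two
    points of [E] are two long segments of one sequence, shifted by a bounded
    amount. *)
Lemma almost_invariant_powers (R : realType) (G : groupType) (X : choiceType)
    (a : left_action G X) (E : seq X) (g : G) (p : X) :
  (forall x, x \in E -> exists i, x = a (g ^+ i)%g p) ->
  forall eps : R, 0 < eps -> exists l, l != [::] /\ almost_invariant a l E eps.
Proof.
move=> Ep eps e0.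
have [K KP] : exists K, forall x, x \in E ->
    exists2 i, (i <= K)%N & x = a (g ^+ i)%g p.
  elim: E Ep => [|y E IH] Ep; first by exists 0%N.
  have [|K KP] := IH; first by move=> x xE; apply: Ep; rewrite inE xE orbT.
  have [|i yi] := Ep y; first exact: mem_head.
  exists (maxn i K) => x; rewrite inE => /predU1P[->|/KP[j jK ->]].
    by exists i => //; rewrite leq_maxl.
  by exists j => //; rewrite leq_max jK orbT.
have [N0 NP] : exists N0 : nat, 4 * K%:R <= eps * N0.+1%:R.
  exists (Num.truncn (4 * K%:R / eps)).
  by rewrite [leRHS]mulrC -ler_pdivrMr// ltW// truncnS_gt.
set N := N0.+1 in NP.
exists [seq (g ^+ i)%g | i <- iota 0 N]; split => //.
move=> f M fM x y /KP[i iK ->] /KP[j jK ->].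
have M0 : 0 <= M by apply: le_trans (fM p).
pose u k := f (a (g ^+ k)%g p).
have uM k : `|u k| <= M by exact: fM.
have S k :
    avg [seq (g ^+ i)%g | i <- iota 0 N] (fun h => f (a h (a (g ^+ k)%g p))) =
    (\sum_(0 <= i < N) u (i + k)%N) / N%:R.
  rewrite /avg size_map size_iota big_map /index_iota subn0; congr (_ / _).
  by apply: eq_bigr => n _; rewrite -actM -expgnDr.
rewrite !S -mulrBl normrM normfV [`|N%:R|]ger0_norm// ler_pdivrMr ?ltr0n//.
set s := \sum_(0 <= i < N) u i.
have Ki : i%:R <= K%:R :> R by rewrite ler_nat.
have Kj : j%:R <= K%:R :> R by rewrite ler_nat.
have hi := sum_shift_bound N i uM; have hj := sum_shift_bound N j uM.
rewrite -(subrKA s) (le_trans (ler_normD _ _))// [in X in _ + X]distrC.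
apply: (le_trans (lerD hi hj)); nra.
Qed.

(** * A translation between dyadic points in Thompson's group *)

Section Shift.
Context (R : realType).
Local Notation I := (set_type (unit_itv R)).

Lemma continuous_restrict (phi : R -> R) (g : I -> I) : continuous phi ->
  (forall x, \val (g x) = phi (\val x)) -> continuous g.
Proof.
move=> cphi gE; apply: (@continuous_comp_initial _ _ _ (set_val : I -> R)).
have -> : set_val \o g = phi \o (set_val : I -> R).
  by apply/funext => x; exact: gE.
move=> x; apply: continuous_comp; first exact: initial_continuous.
exact: cphi.
Qed.

Context (d : R) (d_gt0 : 0 < d) (d_le4 : 4 * d <= 1) (d_dyadic : dyadic d).

(** On the unit interval: slope [2] up to [d], then translation by [d] up to
    [1 - 2 * d], then slope [1 / 2]. Written as a minimum because the function
    is concave, which gives continuity at once. *)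
Definition shift_fun (x : R) : R :=
  Num.min (2 * x) (Num.min (x + d) ((x + 1) / 2)).

(** The inverse of [shift_fun]. *)
Definition unshift_fun (y : R) : R :=
  Num.max (y / 2) (Num.max (y - d) (2 * y - 1)).

Lemma shift_funE x : shift_fun x =
  if x <= d then 2 * x else if x <= 1 - 2 * d then x + d else (x + 1) / 2.
Proof.
by rewrite /shift_fun; case: (leP (x + d)) => ?; case: (leP (2 * x)) => ?;
  repeat (case: leP => ?); move: d_gt0 d_le4; lra.
Qed.

Lemma unshift_funE y : unshift_fun y =
  if y <= 2 * d then y / 2 else if y <= 1 - d then y - d else 2 * y - 1.
Proof.
by rewrite /unshift_fun; case: (leP (y - d)) => ?; case: (leP (y / 2)) => ?;
  repeat (case: leP => ?); move: d_gt0 d_le4; lra.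
Qed.

Lemma shift_funK : cancel shift_fun unshift_fun.
Proof.
by move=> x; rewrite shift_funE; repeat (case: leP => ?); rewrite unshift_funE;
  repeat (case: leP => ?); move: d_gt0 d_le4; lra.
Qed.

Lemma unshift_funK : cancel unshift_fun shift_fun.
Proof.
by move=> x; rewrite unshift_funE; repeat (case: leP => ?); rewrite shift_funE;
  repeat (case: leP => ?); move: d_gt0 d_le4; lra.
Qed.

Lemma shift_fun_homo : {homo shift_fun : x y / x < y}.
Proof.
move=> x y xy; rewrite !shift_funE.
case: (leP x d) => ?; case: (leP y d) => ?; case: (leP x (1 - 2 * d)) => ?;
  by case: (leP y (1 - 2 * d)) => ?; move: d_gt0 d_le4; lra.
Qed.

Lemma shift_fun_itv x : 0 <= x <= 1 -> 0 <= shift_fun x <= 1.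
Proof.
move=> xI; rewrite shift_funE; case: (leP x d) => ?;
  by case: (leP x (1 - 2 * d)) => ?; move: d_gt0 d_le4; lra.
Qed.

Lemma unshift_fun_itv x : 0 <= x <= 1 -> 0 <= unshift_fun x <= 1.
Proof.
move=> xI; rewrite unshift_funE; case: (leP x (2 * d)) => ?;
  by case: (leP x (1 - d)) => ?; move: d_gt0 d_le4; lra.
Qed.

Lemma shift_fun_continuous : continuous shift_fun.
Proof.
move=> x; apply: continuous_min; last apply: continuous_min.
- by apply: cvgM; [exact: cvg_cst|exact: cvg_id].
- by apply: cvgD; [exact: cvg_id|exact: cvg_cst].
- by apply: cvgM; [apply: cvgD; [exact: cvg_id|exact: cvg_cst]|exact: cvg_cst].
Qed.

Lemma unshift_fun_continuous : continuous unshift_fun.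
Proof.
move=> x; apply: (@continuous_max R R (fun y => y / 2)
  ((fun y => y - d) \max (fun y => 2 * y - 1))); last apply: continuous_max.
- by apply: cvgM; [exact: cvg_id|exact: cvg_cst].
- by apply: cvgB; [exact: cvg_id|exact: cvg_cst].
- by apply: cvgB; [apply: cvgM; [exact: cvg_cst|exact: cvg_id]|exact: cvg_cst].
Qed.

Definition shift_itv (x : I) : I :=
  exist _ (shift_fun (\val x)) (unit_itv_in (shift_fun_itv (unit_itvP x))).

Definition unshift_itv (x : I) : I :=
  exist _ (unshift_fun (\val x)) (unit_itv_in (unshift_fun_itv (unit_itvP x))).

Lemma shift_thompson : thompson_set R shift_itv.
Proof.
split.
- split; first exact: continuous_restrict shift_fun_continuous _.
  exists unshift_itv; split.
  + exact: continuous_restrict unshift_fun_continuous _.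
  + by move=> x; apply: val_inj; exact: shift_funK.
  + by move=> x; apply: val_inj; exact: unshift_funK.
- by move=> x y; exact: shift_fun_homo.
exists [:: d; 1 - 2 * d].
  have d1 : dyadic (1 : R) by exists 1, 0%N; rewrite divr1.
  have d2 : dyadic (2 * d) by rewrite -[2]expr1z; exact: dyadic_pow2M.
  by move=> c; rewrite !inE => /orP[]/eqP->//; exact: dyadicB.
move=> p q pq no.
have := no d; rewrite mem_head => /(_ isT) nd.
have := no (1 - 2 * d); rewrite !inE eqxx orbT => /(_ isT) nd'.
have [qd|dq] := leP (\val q) d.
  exists 1, 0 => x xpq; rewrite [LHS]shift_funE expr1z.
  by repeat (case: leP => ?); move: d_gt0 d_le4; lra.
have dp : d <= \val p by rewrite dq andbT -leNgt in nd.
have [qd'|dq'] := leP (\val q) (1 - 2 * d).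
  exists 0, d => x xpq; rewrite [LHS]shift_funE expr0z.
  by repeat (case: leP => ?); move: d_gt0 d_le4; lra.
have dp' : 1 - 2 * d <= \val p by rewrite dq' andbT -leNgt in nd'.
exists (-1), 2^-1 => x xpq; rewrite [LHS]shift_funE.
rewrite (_ : 2 ^ (-1) = 2^-1)//.
by repeat (case: leP => ?); move: d_gt0 d_le4; lra.
Qed.

(** The resulting element of Thompson's group; it moves the multiple [k * d] to
    [k.+1 * d] as long as [1 <= k] and [k.+2 * d <= 1]. *)
Definition shift_elt : thompsonF R :=
  exist _ shift_itv (mem_set shift_thompson).

Lemma shift_elt_iter (p : I) n : \val p = d -> n.+2%:R * d <= 1 ->
  \val (\val (shift_elt ^+ n)%g p) = n.+1%:R * d.
Proof.
move=> pd; elim: n => [|n IH] nd; first by rewrite mul1r.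
rewrite expgS /= IH; last first.
  by apply: le_trans nd; rewrite ler_wpM2r ?ler_nat// ltW.
have := nd; rewrite -[n.+3]addn1 -[n.+2]addn1 -[n.+1]addn1 !natrD => nd'.
have n0 : 0 <= n%:R :> R by [].
have nd0 : 0 <= n%:R * d by rewrite mulr_ge0// ltW.
by rewrite shift_funE; repeat (case: leP => ?); move: d_gt0 d_le4; lra.
Qed.

End Shift.

(** * Countability of Thompson's group *)

Section ThompsonCountable.
Context (R : realType).
Local Notation I := (set_type (unit_itv R)).

Lemma seq_minP (t : seq R) : t != [::] ->
  exists2 p, p \in t & forall q, q \in t -> p <= q.
Proof.
move=> t0; have [|p /mapP[r rt ->] pm] := @seq_maxP R [seq - c | c <- t].
  by case: (t) t0.
by exists r => // q qt; rewrite -lerN2 pm// map_f.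
Qed.

(** The value of [g] at a real number [c], meaningful for [c] in the unit
    interval (elsewhere, the value at [0]). *)
Definition value_at (g : I -> I) (c : R) : R := \val (g (insubd (zeroI R) c)).

(** The points of [s], with both end points among them, subdivide the unit
    interval into pieces on which [g] is affine. *)
Definition affine_subdivision (g : I -> I) (s : seq R) : Prop :=
  [/\ 0 \in s, 1 \in s, {in s, forall c, 0 <= c <= 1} &
    {in s &, forall a b, a < b ->
    (forall c, c \in s -> ~~ (a < c < b)) ->
    exists (k : R) (c : R), forall x : I,
        a <= \val x <= b -> \val (g x) = k * \val x + c}].

(** An affine piece is determined by its values at the two end points. *)
Lemma affine_subdivision_inj (g h : I -> I) (s : seq R) :
  affine_subdivision g s -> affine_subdivision h s ->
  {in s, value_at g =1 value_at h} -> g = h.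
Proof.
move=> [s0 s1 s01 gs] [_ _ _ hs] gh; apply/funext => x; apply: val_inj.
have in_s (y : I) : \val y \in s -> \val (g y) = \val (h y).
  by move=> /gh; rewrite /value_at valKd.
have [/in_s//|xs] := boolP (\val x \in s).
have /andP[x0 x1] := unit_itvP x.
have ne c : c \in s -> c != \val x by move=> cs; apply: contraNneq xs => <-.
have [|p] := @seq_maxP R [seq c <- s | c < \val x].
  suff : 0 \in [seq c <- s | c < \val x] by case: [seq _ <- _ | _].
  by rewrite mem_filter s0 lt_neqAle x0 ne.
rewrite mem_filter => /andP[px ps] pm.
have [|q] := @seq_minP [seq c <- s | \val x < c].
  suff : 1 \in [seq c <- s | \val x < c] by case: [seq _ <- _ | _].
  by rewrite mem_filter s1 lt_neqAle x1 eq_sym ne.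
rewrite mem_filter => /andP[xq qs] qm.
have pq : p < q by exact: lt_trans xq.
have no c : c \in s -> ~~ (p < c < q).
  move=> cs; apply/negP => /andP[pc cq].
  have := ne c cs; rewrite neq_lt => /orP[cx|xc].
    by have := pm c; rewrite mem_filter cs cx leNgt pc => /(_ isT).
  by have := qm c; rewrite mem_filter cs xc leNgt cq => /(_ isT).
have [k [c kc]] := gs p q ps qs pq no.
have [k' [c' kc']] := hs p q ps qs pq no.
pose P : I := exist _ p (unit_itv_in (s01 p ps)).
pose Q : I := exist _ q (unit_itv_in (s01 q qs)).
have eP := in_s P ps; have eQ := in_s Q qs.
rewrite kc ?kc' /= ?lexx ?ltW// in eP; rewrite kc ?kc' /= ?lexx ?ltW// in eQ.
rewrite kc ?kc' ?ltW//.
have kk : (k - k') * (q - p) = 0 by lra.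
have {}kk : k = k'.
  apply/eqP; rewrite -subr_eq0; move/eqP: kk; rewrite mulf_eq0 subr_eq0.
  by case/orP=> // /eqP e; move: pq; rewrite -[q](subrK p) e add0r ltxx.
by rewrite kk; congr (_ + _); move: eP; rewrite kk => /addrI.
Qed.

Lemma thompson_subdivision (u : thompsonF R) : exists s : seq R,
  [/\ affine_subdivision (\val u) s, {in s, forall c, dyadic c} &
    {in s, forall c, dyadic (value_at (\val u) c)}].
Proof.
have [hg gm gpl] := set_mem (valP u).
have [_ [h [_ gh hg']]] := hg; have [s ds gs] := gpl.
(* The end points are added, and listed points outside the interval dropped. *)
pose t := 0 :: 1 :: [seq c <- s | 0 <= c <= 1].
have t01 : {in t, forall c, 0 <= c <= 1}.
  move=> c; rewrite !inE mem_filter => /or3P[/eqP->|/eqP->|/andP[]//];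
  by rewrite !lexx ler01.
have td : {in t, forall c, dyadic c}.
  move=> c; rewrite !inE mem_filter => /or3P[/eqP->|/eqP->|/andP[_ /ds]//].
    exact: dyadic0.
  by exists 1, 0%N; rewrite divr1.
exists t; split => //; last first.
  move=> c ct; apply: (thompson_dyadic gm hg' gpl _).1.
  by rewrite val_insubd; case: ifP => _; [exact: td|exact: dyadic0].
split; rewrite ?inE ?eqxx ?orbT// => a b ha hb ab no.
have [|d dS|k [c kc]] := gs (exist _ a (unit_itv_in (t01 a ha)))
  (exist _ b (unit_itv_in (t01 b hb))) _ _.
- exact: ab.
- apply/negP => /= /andP[ad db].
  suff /no : d \in t by rewrite ad db.
  rewrite !inE mem_filter dS andbT.
  have /andP[a0 _] := t01 a ha; have /andP[_ b1] := t01 b hb.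
  by rewrite (le_trans a0 (ltW ad)) (le_trans (ltW db) b1) !orbT.
- by exists (2 ^ k), c.
Qed.

(** The dyadic number [m / 2 ^ k] coded by the pair [(m, k)]. *)
Definition dyadic_of (c : int * nat) : R := c.1%:~R / 2 ^+ c.2.

Lemma dyadic_codes (s : seq R) : {in s, forall c, dyadic c} ->
  exists cs, s = map dyadic_of cs.
Proof.
elim: s => [|x s IH] sd; first by exists [::].
have [|cs ->] := IH; first by move=> c cs; apply: sd; rewrite inE cs orbT.
by have [|m [n ->]] := sd x; [exact: mem_head|exists ((m, n) :: cs)].
Qed.

(** A code for [u] lists a subdivision and the values of [u] at its points. *)
Definition thompson_code (u : thompsonF R)
    (c : seq (int * nat) * seq (int * nat)) :=
  affine_subdivision (\val u) (map dyadic_of c.1) /\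
  map (value_at (\val u)) (map dyadic_of c.1) = map dyadic_of c.2.

Lemma thompson_code_ex u : exists c, thompson_code u c.
Proof.
have [s [su sd vd]] := thompson_subdivision u.
have [cs e] := dyadic_codes sd.
have [|vs e'] := @dyadic_codes (map (value_at (\val u)) s).
  by move=> _ /mapP[c cs' ->]; exact: vd.
by exists (cs, vs); split; rewrite /= -e.
Qed.

Lemma thompson_code_inj u v c : thompson_code u c -> thompson_code v c -> u = v.
Proof.
move=> [su eu] [sv ev]; apply: val_inj; apply: affine_subdivision_inj su sv _.
by apply/eq_in_map; rewrite eu ev.
Qed.

Lemma thompson_enum :
  exists e : nat -> thompsonF R, forall u, exists n, e n = u.
Proof.
have H n : exists u : thompsonF R,
    forall c, unpickle n = Some c -> forall v, thompson_code v c -> v = u.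
  case: (unpickle n) => [c|]; last by exists 1%g.
  have [[u uc]|no] := pselect (exists u, thompson_code u c).
    by exists u => _ [<-] v vc; exact: thompson_code_inj vc uc.
  by exists 1%g => _ [<-] v vc; exfalso; apply: no; exists v.
exists (fun n => sval (cid (H n))) => u.
have [c uc] := thompson_code_ex u; exists (pickle c).
by case: cid => v /= vP; apply/esym/(vP c) => //; exact: pickleK.
Qed.

End ThompsonCountable.

(** * The orbit of one half *)

Section OrbitOfHalf.
Context (R : realType).
Local Notation I := (set_type (unit_itv R)).
Local Notation orb := (left_orbit (thompson_action R) (half_pt R)).

Lemma thompson_fix1 (u : thompsonF R) (x : I) :
  \val x = 1 -> \val (\val u x) = 1.
Proof.
move=> x1; have [v [_ vu]] := thompson_inv_ex u.
have [_ gm _] := set_mem (valP u).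
have /andP[_ h] := unit_itvP (\val u x).
apply/le_anti; rewrite h /=.
have := thompson_monole gm (\val v x) x; rewrite vu x1 => ->.
by have /andP[] := unit_itvP (\val v x).
Qed.

Lemma orbit_half_dyadic (x : orb) :
  dyadic (\val (\val x)) /\ 0 < \val (\val x) < 1.
Proof.
case: x => x xo /=; have [u _ <-] := set_mem xo.
have [v [_ vu]] := thompson_inv_ex u.
have [_ gm gpl] := set_mem (valP u); split.
  apply: (thompson_dyadic gm vu gpl (half_pt R)).1.
  by exists 1, 1%N; rewrite expr1 mul1r.
have /andP[u0 u1] := unit_itvP (\val u (half_pt R)).
apply/andP; split.
  apply: (@le_lt_trans _ _ (\val (\val u (zeroI R)))).
    by have /andP[] := unit_itvP (\val u (zeroI R)).
  by apply: gm => /=; rewrite invr_gt0.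
have i1 : 0 <= (1 : R) <= 1 by rewrite lexx ler01.
pose one : I := exist _ 1 (unit_itv_in i1).
rewrite -[ltRHS](@thompson_fix1 u one)//.
by apply: gm => /=; rewrite invf_lt1 ?ltr0n// ltr1n.
Qed.

(** Finitely many dyadic points share a denominator. *)
Lemma common_denominator (E : seq orb) : exists n : nat, forall x, x \in E ->
  exists m : nat, \val (\val x) = m.+1%:R * 2^-1 ^+ n.
Proof.
elim: E => [|x E [n nE]]; first by exists 0%N.
have [[z [k zk]] /andP[x0 x1]] := orbit_half_dyadic x.
have z0 : 0 < z.
  by rewrite -(ltr0z R); move: x0; rewrite zk pmulr_lgt0// invr_gt0 exprn_gt0.
case: z z0 zk => // m m0 zk.
have p2 j : (2 : R) ^+ j != 0 by rewrite expf_neq0.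
exists (n + k)%N => y; rewrite inE => /predU1P[->|/nE[j ->]].
- exists (m * 2 ^ n).-1; rewrite prednK ?muln_gt0 ?expn_gt0 ?andbT//.
  rewrite zk natrM natrX exprVn exprD; field.
  by rewrite !p2.
- exists (j.+1 * 2 ^ k).-1; rewrite prednK ?muln_gt0 ?expn_gt0 ?andbT//.
  rewrite natrM natrX !exprVn exprD; field.
  by rewrite !p2.
Qed.

(** With a common denominator [2 ^ n] enlarged to [2 ^ n.+2], so that
    [4 * d <= 1], all points of [E] are reached from [d] by powers of the shift.
    The point [d] is in the orbit because a power of the shift maps it to
    [1 / 2]. *)
Lemma orbit_half_cyclic (E : seq orb) : exists (g : thompsonF R) (p : orb),
  forall x, x \in E -> exists i,
    x = orbit_action (thompson_action R) (half_pt R) (g ^+ i)%g p.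
Proof.
have [n nE] := common_denominator E.
pose N := (2 ^ n.+2)%N; pose d : R := 2^-1 ^+ n.+2.
have d0 : 0 < d by rewrite exprn_gt0// invr_gt0.
have Nd : N%:R * d = 1 by rewrite /N /d natrX exprVn divff// expf_neq0.
have leN k : (k <= N)%N -> k%:R * d <= 1.
  by move=> kN; rewrite -[leRHS]Nd ler_pM2r// ler_nat.
have d4 : 4 * d <= 1.
  by apply: leN; rewrite /N !expnS mulnA leq_pmulr// expn_gt0.
have dd : dyadic d by exists 1, n.+2; rewrite mul1r /d exprVn.
pose g := shift_elt d0 d4 dd.
have d01 : 0 <= d <= 1.
  by rewrite ltW//=; have := leN 1%N; rewrite mul1r; apply; rewrite expn_gt0.
pose D : I := exist _ d (unit_itv_in d01).
have gD k : (k.+2 <= N)%N -> \val (\val (g ^+ k)%g D) = k.+1%:R * d.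
  by move=> kN; apply: shift_elt_iter => //; exact: leN.
have Dhalf : \val (g ^+ (2 ^ n.+1).-1)%g D = half_pt R.
  have p2 : (0 < 2 ^ n.+1)%N by rewrite expn_gt0.
  have NE : N = (2 ^ n.+1 + 2 ^ n.+1)%N by rewrite /N expnS mul2n addnn.
  apply: val_inj; rewrite gD; last by lia.
  by rewrite prednK//=; move: Nd; rewrite NE natrD mulrDl; lra.
have Dorb : D \in left_orbit (thompson_action R) (half_pt R).
  apply/mem_set; exists (g ^+ (2 ^ n.+1).-1)^-1%g => //.
  by rewrite -Dhalf -actM mulVg act1.
exists g, (exist _ D Dorb) => x xE.
have [m xm] := nE x xE; have [_ /andP[_ x1]] := orbit_half_dyadic x.
have xd : \val (\val x) = (4 * m.+1)%:R * d.
  by rewrite xm /d !exprS natrM; field.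
have mN : (4 * m.+1 < N)%N.
  by rewrite -(ltr_nat R) -(ltr_pM2r d0) Nd -xd.
exists (4 * m.+1).-1; apply: val_inj; apply: val_inj.
by rewrite /= gD ?prednK.
Qed.

End OrbitOfHalf.

Theorem theorem3 (R : realType) :
  exists mu : thompsonF R -> R,
    [/\ prob_measure mu, nondegenerate_measure mu, symmetric_measure mu
      & liouville (orbit_action (thompson_action R) (half_pt R)) mu].
Proof.
have [e e_surj] := thompson_enum R.
have ho : half_pt R \in left_orbit (thompson_action R) (half_pt R).
  by apply/mem_set; exists 1%g.
apply: (@exists_liouville_measure _ _ _ _ e (exist _ (half_pt R) ho)) => //.
  case=> x xo; have [u _ ux] := set_mem xo.
  by exists u; apply: val_inj.
move=> E eps e0; have [g [p Ep]] := orbit_half_cyclic E.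
exact: almost_invariant_powers Ep _ e0.
Qed.
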